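(* Let $d\ge 3$. (i) The $d$-dimensional simplex $\alpha_d$ has $z$-vector $z(\alpha_d)=(d+1)^{d!/2}$; that is, it has exactly $d!/2$ zigzags (up to reversal), all of length $d+1$ and without self-intersections. Every zigzag has intersection vector $(0,1)^{d+1}$ if $d\ge 4$, and $(1,1)^2$ if $d=3$. (ii) The $d$-dimensional cross-polytope $\beta_d$ has $z$-vector $z(\beta_d)=(2d)^{2^{d-2}(d-1)!}$; that is, it has exactly $2^{d-2}(d-1)!$ zigzags (up to reversal), all of length $2d$ and without self-intersections. Every zigzag has intersection vector $(0,2)^d$.
   Context: For a $d$-polytope $P$, a flag is a maximal chain $F_1\subset F_2\subset\dots\subset F_d$ of proper nonempty faces with $\dim F_i=i-1$. For $1\le i\le d$, $\sigma_i$ is the involution on flags replacing $F_i$ by the unique other face $F_i'\neq F_i$ with $F_{i-1}\subset F_i'\subset F_{i+1}$ (where $F_0=\emptyset$, $F_{d+1}=P$). Put $T=\sigma_d\sigma_{d-1}\cdots\sigma_1$ ($\sigma_1$ applied first). A zigzag is a circuit $Z=(f_1,\dots,f_l)$ of flags (an orbit of $T$, listed cyclically, up to cyclic shift) with $f_{j+1}=T(f_j)$, indices modulo $l$; $l$ is its length. For a flag $f=(F_1,\dots,F_d)$ there is a unique family of faces $(x_{i,j})_{1\le i\le d,1\le j\le d+1-i}$ with $x_{i,1}=F_i$, $\dim x_{i,j}=i-1$, $x_{i,j}\subset x_{i+1,j}$, $x_{i,j}\subset x_{i+1,j-1}$, and $x_{i,j}\ne x_{i,j-1}$ whenever the indices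 make sense; the reverse of $f$ is the flag $f^t=(x_{1,d},x_{2,d-1},\dots,x_{d,1})$. The reverse of $Z=(f_1,\dots,f_l)$ is the zigzag $Z^t=(f_l^t,\dots,f_1^t)$. A zigzag is identified with its reverse (so zigzags are counted up to reversal). $Z$ has no self-intersections if for no flag $f$ of $Z$ does $\sigma_1(f)$ belong to $Z$ or $Z^t$. For two distinct zigzags $Z_1=(f_{1},\dots,f_{l})$ and $Z_2$, $n_I$ is the number of $j$ with $\sigma_1(f_j)\in Z_2$ and $n_{II}$ the number of $j$ with $\sigma_1(f_j)\in Z_2^t$; replacing $Z_2$ by $Z_2^t$ exchanges the two numbers, and the normalized signature is the pair $(n_I,n_{II})$ with orientation chosen so that $n_I\le n_{II}$. The intersection vector of a zigzag $Z$ is the list of its nonzero normalized signatures with all other zigzags, multiplicities being written as exponents: e.g. $(a,b)^m$ means that $Z$ has normalized signature $(a,b)$ with exactly $m$ other zigzags and $(0,0)$ with all remaining ones. In the $z$-vector, $l^m$ means $m$ zigzags of length $l$ without self-intersections. *)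

(* Defs.v *)
From HB Require Import structures.
From mathcomp Require Import all_boot all_order all_algebra.
From mathcomp Require Import boolp.

Set Implicit Arguments.
Unset Strict Implicit.
Unset Printing Implicit Defensive.

Import Order.TTheory GRing.Theory Num.Theory.
Local Open Scope ring_scope.

(* A polytope P is given as the convex hull of a finite family of points
   [p : V -> 'rV[R]_n]. A face of P is the convex hull of the points of the
   family that it contains, so it is represented by the set of their indices. *)
Section Faces.
Variables (R : realFieldType) (n : nat) (V : finType) (p : V -> 'rV[R]_n).

Definition face (F : {set V}) : Prop :=
  exists (c : 'cV[R]_n) (b : R),
    (forall v, (p v *m c) 0 0 <= b) /\
    (forall v, (v \in F) = ((p v *m c) 0 0 == b)).

(* Dimension of the affine span; it is meaningful only for F nonempty. *)
Definition face_dim (F : {set V}) : nat :=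
  \rank (\sum_(u in F) \sum_(v in F) <<p u - p v>>)%MS.

End Faces.

Section Zigzags.
Variables (R : realFieldType) (n : nat) (V : finType) (p : V -> 'rV[R]_n).
(* The dimension of the polytope. *)
Variable d : nat.

(* The face F_i of a flag (F_1, ..., F_d) is the value at the ordinal i - 1,
   i.e., the index of a face is its dimension. *)
Definition is_flag (f : {ffun 'I_d -> {set V}}) : Prop :=
  (forall i, [/\ face p (f i), f i != set0, f i != [set: V]
               & face_dim p (f i) = i]) /\
  (forall i j : 'I_d, (i < j)%N -> f i \proper f j).

Definition flag : Type := {f : {ffun 'I_d -> {set V}} | `[< is_flag f >]}.
HB.instance Definition _ := Finite.on flag.

(* [sigma i] is indexed from 1 to d; it is total, with the dummy value f when
   there is no other flag that differs from f in F_i only. *)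
Definition sigma (i : nat) (f : flag) : flag :=
  odflt f [pick g : flag |
    (g != f) && [forall j : 'I_d, (j.+1 != i) ==> (val g j == val f j)]].

Definition T (f : flag) : flag :=
  foldl (fun g i => sigma i g) f (iota 1 d).

(* [x i j] stands for x_{i+1,j+1}, so the indices range over i + j < d. *)
Definition reverse_family (f : flag) (x : nat -> nat -> {set V}) : Prop :=
  [/\ forall i : 'I_d, x i 0%N = val f i,
      forall i j, (i + j < d)%N ->
        [/\ face p (x i j), x i j != set0 & face_dim p (x i j) = i],
      forall i j, (i.+1 + j < d)%N -> x i j \subset x i.+1 j,
      forall i j, (i + j.+1 < d)%N -> x i j.+1 \subset x i.+1 j
    & forall i j, (i + j.+1 < d)%N -> x i j.+1 != x i j].

Definition is_reverse (f g : flag) : Prop :=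
  exists2 x, reverse_family f x & forall i : 'I_d, val g i = x i (rev_ord i).

Definition flag_rev (f : flag) : flag :=
  odflt f [pick g : flag | `[< is_reverse f g >]].

(* A zigzag (f_1, ..., f_l), taken up to cyclic shift, is represented by the
   set of its flags: f_{j+1} = T f_j recovers the cyclic order. *)
Definition zigzag_of (f : flag) : {set flag} := [set g in orbit T f].

Definition zigzags : {set {set flag}} := [set zigzag_of f | f : flag].

Definition zrev (Z : {set flag}) : {set flag} := [set flag_rev f | f in Z].

Definition zclass (Z : {set flag}) : {set {set flag}} := [set Z; zrev Z].

Definition zclasses : {set {set {set flag}}} := [set zclass Z | Z in zigzags].

Definition self_intersecting (Z : {set flag}) : bool :=
  [exists f in Z, (sigma 1 f \in Z) || (sigma 1 f \in zrev Z)].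

(* [has_z_vector l m]: the z-vector is l^m. *)
Definition has_z_vector (l m : nat) : Prop :=
  #|zclasses| = m /\
  (forall Z, Z \in zigzags -> #|Z| = l /\ ~~ self_intersecting Z).

(* The pair (n_I, n_II). *)
Definition signature (Z1 Z2 : {set flag}) : nat * nat :=
  (#|[set f in Z1 | sigma 1 f \in Z2]|, #|[set f in Z1 | sigma 1 f \in zrev Z2]|).

Definition normalized_signature (Z1 Z2 : {set flag}) : nat * nat :=
  let s := signature Z1 Z2 in
  if (s.1 <= s.2)%N then s else signature Z1 (zrev Z2).

(* The intersection vector as a multiset: [intersection_vector Z s] is the
   exponent of s, i.e., the number of zigzags (up to reversal) other than Z
   whose normalized signature with Z is s, for s nonzero. *)
Definition intersection_vector (Z : {set flag}) (s : nat * nat) : nat :=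
  if s == (0, 0)%N then 0%N else
  #|[set zclass Z' | Z' in zigzags &
       (Z' \notin zclass Z) && (normalized_signature Z Z' == s)]|.

(* [has_intersection_vector Z s m]: the intersection vector of Z is s^m. *)
Definition has_intersection_vector (Z : {set flag}) (s : nat * nat) (m : nat) :
    Prop :=
  forall t, intersection_vector Z t = if t == s then m else 0%N.

End Zigzags.

(* The vertices of the d-simplex: the standard basis of R^(d+1). *)
Definition simplex (R : realFieldType) (d : nat) (i : 'I_d.+1) : 'rV[R]_d.+1 :=
  delta_mx 0 i.

(* The vertices of the d-dimensional cross-polytope: e_i and - e_i. *)
Definition cross_polytope (R : realFieldType) (d : nat) (v : 'I_d * bool) :
    'rV[R]_d :=
  (-1) ^+ v.2 *: delta_mx 0 v.1.

(* Main.v *)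
Require Import Defs.
From mathcomp Require Import all_boot all_order all_algebra.
From mathcomp Require Import boolp zify ring.

(* In both polytopes a flag amounts to an ordering (v_1, ..., v_d) of the
   vertices of a facet, sigma_i (i < d) exchanges v_i and v_(i+1), and T drops
   v_1 and appends the vertex opposite to v_1 across the ridge {v_2, ..., v_d}.
   Iterating T lists every vertex of the polytope exactly once before it comes
   back, so a flag is a bijection w from Z/N to the vertices with F_i =
   {w_0, ..., w_(i-1)}: N = d + 1 for the simplex; for the cross-polytope
   N = 2 d and w_(k+d) is the antipode of w_k. On these bijections T, the
   reversal and sigma_1 act by precomposition with k -> k + 1, k -> d - 1 - k
   and the transposition (0 1), resp. (0 1)(d d+1). Since w is injective, every
   coincidence between zigzags becomes an identity between permutations of Z/N
   that does not involve w, and the numbers of zigzags are quotients of the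
   number of flags by the size 2 N of a dihedral orbit. *)

Set Implicit Arguments.
Unset Strict Implicit.
Unset Printing Implicit Defensive.

Import Order.TTheory GRing.Theory Num.Theory.

(** * Zigzags of flags encoded by injections of Z/N into the vertices *)

Section CyclicEncoding.
Local Open Scope ring_scope.
Variables (R : realFieldType) (n : nat) (V : finType) (p : V -> 'rV[R]_n).
Variables (d N : nat).
Hypothesis N_gt1 : (1 < N)%N.
Hypothesis two_neq0 : 2%:R != 0 :> 'Z_N.
Variables (c : 'Z_N) (tau : 'Z_N -> 'Z_N) (enc : flag p d -> 'Z_N -> V).
Hypothesis enc_eq : forall f g, enc f =1 enc g -> f = g.
Hypothesis enc_inj : forall f, injective (enc f).
Hypothesis enc_T : forall f k, enc (T f) k = enc f (k + 1).
Hypothesis enc_rev : forall f k, enc (flag_rev f) k = enc f (c - k).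
Hypothesis enc_sigma1 : forall f k, enc (sigma 1 f) k = enc f (tau k).
(** Shifts and reflections of the index stay on a zigzag and its reverse; keeping [tau] out of this
    dihedral group is what excludes self-intersections. *)
Hypothesis tau_not_shift : forall a, ~ (forall k, tau k = k + a).
Hypothesis tau_not_reflection : forall b, ~ (forall k, tau k = b - k).

Implicit Types f g h : flag p d.

Let rotate (i : 'Z_N) (f : flag p d) : flag p d := iter i (@T _ _ _ p d) f.

Lemma enc_iter m f k : enc (iter m (@T _ _ _ p d) f) k = enc f (k + m%:R).
Proof.
elim: m k => [|m IHm] k; first by rewrite addr0.
by rewrite iterS enc_T IHm -addrA -mulrS.
Qed.

Lemma enc_rotate i f k : enc (rotate i f) k = enc f (k + i).
Proof. by rewrite /rotate enc_iter natr_Zp. Qed.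

Lemma rotate_inj f : injective (rotate^~ f).
Proof.
move=> i j /(congr1 (enc^~ 0)); rewrite /= !enc_rotate !add0r.
exact: enc_inj.
Qed.

(** A flag is determined by its code, and iterating [T] realizes every translation of the index. *)
Lemma mem_zigzag f g :
  reflect (exists a, forall k, enc g k = enc f (k + a)) (g \in zigzag_of f).
Proof.
rewrite inE -fconnect_orbit; apply: (iffP idP) => [/iter_findex <-|[a ga]].
  by eexists => k; rewrite enc_iter.
have -> : g = rotate a f by apply: enc_eq => k; rewrite enc_rotate ga.
exact: fconnect_iter.
Qed.

Lemma zigzagE f : zigzag_of f = [set rotate i f | i : 'Z_N].
Proof.
apply/setP => g; apply/mem_zigzag/imsetP => [[a ga]|[a _ ->]]; exists a => //.
  by apply: enc_eq => k; rewrite enc_rotate.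
by move=> k; rewrite enc_rotate.
Qed.

Lemma card_indices : #|'Z_N| = N.
Proof. by rewrite card_ord Zp_cast. Qed.

Lemma card_zigzag f : #|zigzag_of f| = N.
Proof. by rewrite zigzagE card_imset ?card_indices //; apply: rotate_inj. Qed.

Lemma zigzag_refl f : f \in zigzag_of f.
Proof. by apply/mem_zigzag; exists 0 => k; rewrite addr0. Qed.

Lemma eq_zigzag f g : (zigzag_of g == zigzag_of f) = (g \in zigzag_of f).
Proof.
apply/eqP/mem_zigzag => [eq_gf | [a ga]].
  by apply/mem_zigzag; rewrite -eq_gf zigzag_refl.
apply/setP => h; apply/mem_zigzag/mem_zigzag => -[b hb].
  by exists (b + a) => k; rewrite hb ga addrA.
by exists (b - a) => k; rewrite hb ga addrA subrK.
Qed.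

Lemma flag_revK : involutive (@flag_rev _ _ _ p d).
Proof. by move=> f; apply: enc_eq => k; rewrite !enc_rev subKr. Qed.

(** The reflection k -> c - k composed with translations gives all reflections, so the constant [c]
    is absorbed into [b]. *)
Lemma mem_zigzag_rev f g :
  reflect (exists b, forall k, enc g k = enc f (b - k))
          (g \in zigzag_of (flag_rev f)).
Proof.
apply: (iffP (mem_zigzag _ _)) => -[a ga].
  by exists (c - a) => k; rewrite ga enc_rev opprD [- k - a]addrC addrA.
by exists (c - a) => k; rewrite ga enc_rev; congr enc; ring.
Qed.

Lemma mem_rev_zigzag f g :
  (flag_rev g \in zigzag_of f) = (g \in zigzag_of (flag_rev f)).
Proof.
apply/mem_zigzag/mem_zigzag_rev => -[a ga].
  exists (c + a) => k.
  by rewrite -[g]flag_revK enc_rev ga addrAC.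
by exists (a - c) => k; rewrite enc_rev ga; congr enc; ring.
Qed.

Lemma zrev_zigzag f : zrev (zigzag_of f) = zigzag_of (flag_rev f).
Proof.
apply/setP => g; rewrite -mem_rev_zigzag; apply/imsetP/idP => [[h hf ->]|gf].
  by rewrite flag_revK.
by exists (flag_rev g); rewrite ?flag_revK.
Qed.

Lemma zigzag_rev_disjoint f g :
  g \in zigzag_of f -> g \in zigzag_of (flag_rev f) -> False.
Proof.
move=> /mem_zigzag[a ga] /mem_zigzag_rev[b gb].
(* A shift would equal a reflection; comparing the indices 0 and 1 gives 2 = 0. *)
have shift k : k + a = b - k by apply: (@enc_inj f); rewrite -ga -gb.
have := shift 0; have := shift 1; rewrite add0r subr0 => /[swap] -> h.
case/eqP: two_neq0; have -> : 2%:R = (1 + b) - (b - 1) :> 'Z_N by ring.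
by rewrite h subrr.
Qed.

Definition same_class f g :=
  (g \in zigzag_of f) || (g \in zigzag_of (flag_rev f)).

Lemma zclass_zigzag f :
  zclass (zigzag_of f) = [set zigzag_of f; zigzag_of (flag_rev f)].
Proof. by rewrite /zclass zrev_zigzag. Qed.

Lemma mem_zclass f g : (zigzag_of g \in zclass (zigzag_of f)) = same_class f g.
Proof. by rewrite zclass_zigzag !inE !eq_zigzag. Qed.

Lemma eq_zclass f g :
  (zclass (zigzag_of g) == zclass (zigzag_of f)) = same_class f g.
Proof.
rewrite -mem_zclass; apply/eqP/idP => [<-|].
  by rewrite zclass_zigzag set21.
rewrite zclass_zigzag !inE => /orP[]/eqP eq_g.
  by rewrite /zclass eq_g !zrev_zigzag.
rewrite /zclass eq_g !zrev_zigzag.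
by rewrite flag_revK setUC.
Qed.

(** A zigzag and its reverse are disjoint orbits of [N] flags each; in particular no zigzag is its
    own reverse. *)
Lemma same_class_card f : #|[set g | same_class f g]| = (2 * N)%N.
Proof.
have -> : [set g | same_class f g] = zigzag_of f :|: zigzag_of (flag_rev f).
  by apply/setP => g; rewrite !inE.
rewrite cardsU !card_zigzag.
suff -> : zigzag_of f :&: zigzag_of (flag_rev f) = set0.
  by rewrite cards0 subn0 mul2n addnn.
apply/setP => g; rewrite in_set0 in_setI; apply/negP => /andP[].
exact: zigzag_rev_disjoint.
Qed.

(** The flags split into the fibres of the map sending a flag to the class of its zigzag, all of the
    same size. *)
Lemma card_zclasses : (#|zclasses p d| * (2 * N) = #|{: flag p d}|)%N.
Proof.
rewrite -[RHS]sum1_card -sum_nat_const.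
rewrite [RHS](partition_big (fun f => zclass (zigzag_of f))
                            (mem (zclasses p d))) /=.
  apply: eq_bigr => _ /imsetP[_ /imsetP[f _ ->] ->] /=.
  rewrite -(same_class_card f) -sum1dep_card; apply: eq_bigl => g.
  by rewrite eq_zclass.
by move=> f _; do 2 apply: imset_f.
Qed.

(** For a flag that is [f] shifted by [a], a self-intersection would mean tau k + a = k + b or tau k
    + a = b - k for all k. *)
Lemma zigzag_not_self_intersecting f : ~~ self_intersecting (zigzag_of f).
Proof.
apply/negP => /existsP[g /andP[gf]]; rewrite zrev_zigzag.
have [a ga] := mem_zigzag _ _ gf.
case/orP => [/mem_zigzag|/mem_zigzag_rev] [b hb].
  apply: (@tau_not_shift (b - a)) => k; apply: (addIr a); apply: (@enc_inj f).
  by rewrite -ga -enc_sigma1 hb addrA subrK.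
apply: (@tau_not_reflection (b - a)) => k; apply: (addIr a); apply: (@enc_inj f).
by rewrite -ga -enc_sigma1 hb; congr enc; ring.
Qed.

Lemma cyclic_z_vector m :
  (#|{: flag p d}| = m * (2 * N))%N -> has_z_vector p d N m.
Proof.
move=> card_m; split=> [|_ /imsetP[f _ ->]].
  apply/eqP; rewrite -(@eqn_pmul2r (2 * N)) ?muln_gt0 ?(ltnW N_gt1) //.
  by rewrite card_zclasses card_m.
by rewrite card_zigzag zigzag_not_self_intersecting.
Qed.

(* [i] is in the first (second) set iff, for every flag [f] and index [j], the
   flags [sigma 1 (T^(j+i) f)] and [sigma 1 (T^j f)] lie on the same zigzag (on
   zigzags that are reverse to each other). *)
Definition shift_meets : {set 'Z_N} :=
  [set i | [exists a, forall k, tau k + i == tau (k + a)]].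
Definition reflection_meets : {set 'Z_N} :=
  [set i | [exists b, forall k, tau k + i == tau (b - k)]].

(** As [i] runs over Z/N, these are the images under [sigma 1] of all flags on the zigzag of [f]. *)
Let neighbour f i := sigma 1 (rotate i f).

Lemma enc_neighbour f i k : enc (neighbour f i) k = enc f (tau k + i).
Proof. by rewrite enc_sigma1 enc_rotate. Qed.

(** Injectivity of the code cancels [f], so only the difference of the indices matters. *)
Lemma neighbour_mem_shift f i j :
  (neighbour f i \in zigzag_of (neighbour f j)) = (i - j \in shift_meets).
Proof.
rewrite [RHS]inE; apply/mem_zigzag/existsP => -[a].
  move=> ha; exists a; apply/forallP => k; rewrite addrA subr_eq; apply/eqP.
  by apply: (@enc_inj f); rewrite -!enc_neighbour.
move=> /forallP ha; exists a => k; rewrite !enc_neighbour.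
by rewrite -(eqP (ha k)) addrA subrK.
Qed.

Lemma neighbour_mem_reflection f i j :
  (neighbour f i \in zigzag_of (flag_rev (neighbour f j))) =
  (i - j \in reflection_meets).
Proof.
rewrite [RHS]inE; apply/mem_zigzag_rev/existsP => -[a].
  move=> ha; exists a; apply/forallP => k; rewrite addrA subr_eq; apply/eqP.
  by apply: (@enc_inj f); rewrite -!enc_neighbour.
move=> /forallP ha; exists a => k; rewrite !enc_neighbour.
by rewrite -(eqP (ha k)) addrA subrK.
Qed.

Lemma card_neighbours f (A : {set flag p d}) :
  #|[set g in zigzag_of f | sigma 1 g \in A]| =
  #|[set i | neighbour f i \in A]|.
Proof.
rewrite -[RHS](card_imset _ (@rotate_inj f)); apply: eq_card => g.
rewrite inE zigzagE; apply/andP/imsetP => [[/imsetP[i _ ->] Ag]|[i]].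
  by exists i; rewrite ?inE.
by rewrite inE => Ai ->; split=> //; apply: imset_f.
Qed.

Lemma card_translate (A : {set 'Z_N}) j : #|[set i | i - j \in A]| = #|A|.
Proof.
rewrite -(card_preimset A (addIr (- j))); apply: eq_card => i.
by rewrite !inE.
Qed.

Lemma signature_neighbour f j :
  signature (zigzag_of f) (zigzag_of (neighbour f j)) =
  (#|shift_meets|, #|reflection_meets|).
Proof.
rewrite /signature zrev_zigzag !card_neighbours.
congr pair; rewrite -[RHS](card_translate _ j); apply: eq_card => i.
  by rewrite [LHS]in_set [RHS]in_set -(neighbour_mem_shift f).
by rewrite [LHS]in_set [RHS]in_set -(neighbour_mem_reflection f).
Qed.

Lemma zrevK f : zrev (zrev (zigzag_of f)) = zigzag_of f.
Proof. by rewrite !zrev_zigzag flag_revK. Qed.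

Lemma signature_rev f g : signature (zigzag_of f) (zrev (zigzag_of g)) =
  ((signature (zigzag_of f) (zigzag_of g)).2,
   (signature (zigzag_of f) (zigzag_of g)).1).
Proof. by rewrite /signature /= zrevK. Qed.

(** Reversing the second zigzag exchanges the two numbers, so normalizing amounts to sorting the
    pair. *)
Lemma normalized_signatureE f g :
  let s := signature (zigzag_of f) (zigzag_of g) in
  normalized_signature (zigzag_of f) (zigzag_of g) =
  (minn s.1 s.2, maxn s.1 s.2).
Proof.
move=> s; rewrite /normalized_signature signature_rev -/s.
by case: s => a b /=; case: leqP => h; congr pair; lia.
Qed.

Lemma normalized_signature_rev f g :
  normalized_signature (zigzag_of f) (zigzag_of (flag_rev g)) =
  normalized_signature (zigzag_of f) (zigzag_of g).
Proof.
by rewrite !normalized_signatureE -zrev_zigzag signature_rev /= minnC maxnC.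
Qed.

(** The normalized signature of a zigzag with every class that it meets. *)
Let nsig := (minn #|shift_meets| #|reflection_meets|,
             maxn #|shift_meets| #|reflection_meets|).

Lemma shift_meets0 : 0 \in shift_meets.
Proof.
by rewrite inE; apply/existsP; exists 0; apply/forallP => k; rewrite !addr0.
Qed.

Lemma same_class_neighbour f i : ~~ same_class f (neighbour f i).
Proof.
have := zigzag_not_self_intersecting f; apply: contra => Hi.
apply/existsP; exists (rotate i f); rewrite zrev_zigzag [X in _ && X]Hi andbT.
by rewrite zigzagE; apply/imsetP; exists i.
Qed.

Lemma nsig_neighbour f g i : same_class g (neighbour f i) ->
  normalized_signature (zigzag_of f) (zigzag_of g) = nsig.
Proof.
rewrite /same_class -!eq_zigzag => /orP[]/eqP eq_g.
  by rewrite -eq_g normalized_signatureE signature_neighbour.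
rewrite -normalized_signature_rev -eq_g normalized_signatureE.
by rewrite signature_neighbour.
Qed.

(** A nonzero count exhibits a flag of the first zigzag that [sigma 1] sends to the second one or
    its reverse. *)
Lemma nsig_nonzero f g :
  normalized_signature (zigzag_of f) (zigzag_of g) != (0, 0)%N ->
  exists i, same_class g (neighbour f i).
Proof.
move=> s_neq0; apply/existsP; apply: contraNT s_neq0.
rewrite negb_exists => /forallP no_g.
suff eq_s : signature (zigzag_of f) (zigzag_of g) = (0, 0)%N.
  by rewrite normalized_signatureE eq_s.
rewrite /signature zrev_zigzag !card_neighbours.
by congr pair; apply: eq_card0 => i; rewrite in_set; apply: contraNF (no_g i);
  rewrite /same_class => ->; rewrite ?orbT.
Qed.

(** The [N] indices are partitioned by the class of [neighbour f i]. The fibre through [j] is the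
    translate by [j] of the union of the two sets of meets, which are disjoint because a zigzag is
    disjoint from its reverse. *)
Lemma card_neighbour_classes f :
  (#|[set zclass (zigzag_of (neighbour f i)) | i : 'Z_N]| *
    (#|shift_meets| + #|reflection_meets|) = N)%N.
Proof.
rewrite -sum_nat_const -[RHS]card_indices -[RHS]sum1_card.
rewrite (partition_big_imset (fun i => zclass (zigzag_of (neighbour f i)))) /=.
apply: eq_bigr => _ /imsetP[j _ ->].
rewrite -(card_translate shift_meets j) -(card_translate reflection_meets j).
rewrite -cardsUI [X in (_ + X)%N]eq_card0 ?addn0.
  rewrite sum1dep_card. apply: eq_card => i.
  rewrite [RHS]in_set eq_zclass /same_class neighbour_mem_shift.
  rewrite neighbour_mem_reflection in_setU.
  by congr (_ || _); rewrite [LHS]in_set.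
move=> i; rewrite in_setI [X in X && _]in_set [X in _ && X]in_set.
rewrite -(neighbour_mem_shift f) -(neighbour_mem_reflection f).
by apply/negP => /andP[]; apply: zigzag_rev_disjoint.
Qed.

(** All classes met by the zigzag share the signature [nsig], the others have signature (0, 0), and
    [N] divided by the fibre size [a + b] counts the former. *)
Lemma cyclic_intersection_vector a b m :
  #|shift_meets| = a -> #|reflection_meets| = b -> (m * (a + b) = N)%N ->
  forall Z, Z \in zigzags p d ->
    has_intersection_vector Z (minn a b, maxn a b) m.
Proof.
move=> card_a card_b mN _ /imsetP[f _ ->] t; rewrite -card_a -card_b -/nsig.
have a_gt0 : (0 < #|shift_meets|)%N.
  by apply/card_gt0P; exists 0; apply: shift_meets0.
have nsig_neq0 : nsig != (0, 0)%N.
  by apply: contraTneq a_gt0 => -[_ max0]; rewrite -leqNgt -max0 leq_maxl.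
rewrite /intersection_vector; case: eqP => [->|/eqP t_neq0].
  by rewrite eq_sym (negPf nsig_neq0).
case: eqP => [->|/eqP t_neq].
  have -> : m = #|[set zclass (zigzag_of (neighbour f i)) | i : 'Z_N]|.
    apply/eqP; rewrite -(@eqn_pmul2r (a + b)); last first.
      by rewrite -card_a addn_gt0 a_gt0.
    by rewrite mN -card_a -card_b card_neighbour_classes.
  apply: eq_card => C; apply/imsetP/imsetP => [[Z' Z'P ->]|[i _ ->]].
    move: Z'P; rewrite inE => /and3P[/imsetP[g _ ->] _ /eqP s_g].
    have [|i] := @nsig_nonzero f g; first by rewrite s_g.
    by rewrite -eq_zclass => /eqP <-; exists i.
  exists (zigzag_of (neighbour f i)); rewrite // inE imset_f //=.
  rewrite mem_zclass same_class_neighbour /=.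
  by apply/eqP/(@nsig_neighbour _ _ i); rewrite /same_class zigzag_refl.
apply: eq_card0 => C; apply/imsetP => -[Z'].
rewrite inE => /and3P[/imsetP[g _ ->] _ /eqP s_g] _.
have [|i /nsig_neighbour s_g'] := @nsig_nonzero f g; first by rewrite s_g.
by move: t_neq; rewrite -s_g s_g' eqxx.
Qed.

End CyclicEncoding.

(** * The involution (0 1)(e e+1) of Z/N compared with its dihedral translates *)

Section SwapIndices.
Local Open Scope ring_scope.
Variables (N : nat) (e : 'Z_N).

(** Congruence modulo {0, e}, a subgroup once [ee0] is assumed: indices of antipodal vertices are
    identified. *)
Definition modulo_e (j x : 'Z_N) := (x == j) || (x == j + e).

(* [e = 0] for the simplex and [e = d] for the cross-polytope. *)
Definition swap01 (x : 'Z_N) : 'Z_N :=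
  if modulo_e 0 x then x + 1 else if modulo_e 1 x then x - 1 else x.

Lemma modulo_e_shift a j x : modulo_e (j + a) (x + a) = modulo_e j x.
Proof.
rewrite /modulo_e (inj_eq (addIr a)).
by rewrite -addrA [a + e]addrC addrA (inj_eq (addIr a)).
Qed.

Hypothesis ee0 : e + e = 0.

Lemma modulo_e_addr j x : modulo_e j (x + e) = modulo_e j x.
Proof.
have eN : - e = e by apply/eqP; rewrite eq_sym -addr_eq0 ee0.
rewrite /modulo_e (inj_eq (addIr e)) orbC; congr orb.
by rewrite -subr_eq eN.
Qed.

Lemma swap01_addr x : swap01 (x + e) = swap01 x + e.
Proof.
rewrite /swap01 !modulo_e_addr; case: ifP => _; first by rewrite addrAC.
by case: ifP => _; rewrite // addrAC.
Qed.

Hypothesis n1 : 1%:R != 0 :> 'Z_N.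
Hypothesis n2 : 2%:R != 0 :> 'Z_N.
Hypothesis n3 : 3%:R != 0 :> 'Z_N.
Hypothesis e1 : e != 1.
Hypothesis e2 : e != 2%:R.

(** As - e = e, representatives of the two cosets differ by c or by c - e, and neither vanishes. *)
Lemma modulo_e_exclusive (i j c x : 'Z_N) : j = i + c -> c != 0 -> e != c ->
  modulo_e i x -> modulo_e j x = false.
Proof.
move=> -> c_neq0 c_neqe; apply: contraTF.
rewrite /modulo_e negb_or => /orP[]/eqP ->; apply/andP; split; rewrite -subr_eq0.
- by have -> : i + c - i = c by ring.
- have -> : i + c - (i + e) = - (e - c) by ring.
  by rewrite oppr_eq0 subr_eq0.
- have -> : i + c + e - i = e + e - (e - c) by ring.
  by rewrite ee0 sub0r oppr_eq0 subr_eq0.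
- by have -> : i + c + e - (i + e) = c by ring.
Qed.

Lemma swap01_near0 x : modulo_e 0 x -> swap01 x = x + 1.
Proof. by rewrite /swap01 => ->. Qed.

Lemma swap01_near1 x : modulo_e 1 x -> swap01 x = x - 1.
Proof.
move=> x1; rewrite /swap01 x1; case: ifP => // x0.
by move: x1; rewrite (modulo_e_exclusive _ n1 e1 x0) // add0r.
Qed.

Lemma swap01_near2 x : modulo_e 2%:R x -> swap01 x = x.
Proof.
move=> x2; rewrite /swap01; case: ifP => x0.
  by move: x2; rewrite (modulo_e_exclusive _ n2 e2 x0) // add0r.
case: ifP => // x1.
by move: x2; rewrite (modulo_e_exclusive _ n1 e1 x1) // -natrD.
Qed.

Lemma swap01_nearN1 x : modulo_e (- 1) x -> swap01 x = x.
Proof.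
move=> x2; rewrite /swap01 (modulo_e_exclusive _ n1 e1 x2) ?addNr //.
by rewrite (modulo_e_exclusive _ n2 e2 x2) //; ring.
Qed.

Lemma modulo_e_refl j : modulo_e j j.
Proof. by rewrite /modulo_e eqxx. Qed.

Let absurd_eq (x y c : 'Z_N) : c != 0 -> x = y -> x - y = c -> False.
Proof. by move=> c_neq0 -> /eqP; rewrite subrr eq_sym (negPf c_neq0). Qed.

Lemma swap01_0 : swap01 0 = 1.
Proof. by rewrite swap01_near0 ?modulo_e_refl // add0r. Qed.

Lemma swap01_1 : swap01 1 = 0.
Proof. by rewrite swap01_near1 ?modulo_e_refl // subrr. Qed.

Lemma swap01_2 : swap01 2%:R = 2%:R.
Proof. by rewrite swap01_near2 ?modulo_e_refl. Qed.

Lemma swap01K : involutive swap01.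
Proof.
move=> x; have [x0|x0] := boolP (modulo_e 0 x).
  rewrite (swap01_near0 x0) swap01_near1 ?addrK //.
  by have := modulo_e_shift 1 0 x; rewrite add0r x0.
have [x1|x1] := boolP (modulo_e 1 x).
  rewrite (swap01_near1 x1) swap01_near0 ?subrK //.
  by rewrite -(modulo_e_shift 1) add0r subrK.
by rewrite /swap01 (negPf x0) (negPf x1) (negPf x0) (negPf x1).
Qed.

Lemma swap01_not_shift a : ~ (forall k, swap01 k = k + a).
Proof.
move=> h; have := h 2%:R; rewrite swap01_2 -{1}[2%:R]addr0 => /addrI a0.
by have /eqP := h 0; rewrite swap01_0 -a0 addr0 (negPf n1).
Qed.

Lemma swap01_not_reflection b : ~ (forall k, swap01 k = b - k).
Proof.
move=> h; have := h 0; rewrite swap01_0 subr0 => b1.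
have := h 2%:R; rewrite swap01_2 -b1 => h2.
by apply: (absurd_eq n3 h2); ring.
Qed.

Lemma shift_meets_swap01 : shift_meets swap01 = [set 0; e].
Proof.
apply/setP => i; rewrite !inE; apply/existsP/idP => [[a /forallP h]|].
  (* The indices 0 and 1 suffice: they give 1 + i = swap01 a and i = swap01 (1 + a). Unless [a] is 0
     modulo {0, e}, every case is contradictory, by 2 = 0 or 3 = 0. *)
  have h0 := eqP (h 0); have h1 := eqP (h 1).
  move: h0 h1; rewrite swap01_0 swap01_1 add0r add0r => h0 h1.
  have [a0|a_not0] := boolP (modulo_e 0 a).
    move: h0; rewrite swap01_near0 // addrC => /addIr ->.
    by move: a0; rewrite /modulo_e add0r.
  have [a1|a_not1] := boolP (modulo_e 1 a).
    exfalso; move: h0; rewrite swap01_near1 // => h0.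
    move: h1; rewrite swap01_near2; last first.
      by rewrite [2%:R]mulr2n addrC modulo_e_shift.
    move=> h1; move: h0; rewrite h1 => h0.
    by apply: (absurd_eq n3 h0); ring.
  exfalso; move: h0; rewrite {1}/swap01 (negPf a_not0) (negPf a_not1) => h0.
  have [a0|a1_not0] := boolP (modulo_e 0 (1 + a)).
    move: h1; rewrite swap01_near0 // -h0 => h1.
    by apply: (absurd_eq n3 (esym h1)); ring.
  have a1_not1 : modulo_e 1 (1 + a) = false.
    by have := modulo_e_shift 1 0 a; rewrite add0r addrC (negPf a_not0).
  move: h1; rewrite /swap01 (negPf a1_not0) a1_not1 -h0 => h1.
  by apply: (absurd_eq n2 (esym h1)); ring.
case/orP => /eqP ->; [exists 0|exists e]; apply/forallP => k.
  by rewrite !addr0.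
by rewrite swap01_addr.
Qed.

(** The indices 0, 1 and 2 give the values 1 + i, i and 2 + i of [swap01] at b, b - 1 and b - 2.
    Splitting on the cosets of these arguments is contradictory in every branch but one, where b = 1
    + i and b - 2 is in the coset of 1; there 4 = 0. *)
Lemma reflection_meets_swap01 i : i \in reflection_meets swap01 ->
  4%:R = 0 :> 'Z_N /\ modulo_e 2%:R i.
Proof.
rewrite inE => /existsP[b /forallP h].
have := eqP (h 0); have := eqP (h 1); have := eqP (h 2%:R).
rewrite swap01_0 swap01_1 swap01_2 subr0 add0r => h2 h1 h0.
have [b0|b_not0] := boolP (modulo_e 0 b).
  exfalso; move: h0; rewrite swap01_near0 // addrC => /addIr ib.
  move: h1; rewrite swap01_nearN1; last first.
    by have := modulo_e_shift (-1) 0 b; rewrite add0r b0.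
  by rewrite ib => h1; apply: (absurd_eq n1 h1); ring.
have [b1|b_not1] := boolP (modulo_e 1 b).
  exfalso; move: h0; rewrite swap01_near1 // => h0.
  move: h1; rewrite swap01_near0; last by rewrite -(modulo_e_shift 1) add0r subrK.
  by rewrite subrK => ib; apply: (absurd_eq n2 h0); rewrite ib; ring.
move: h0; rewrite /swap01 (negPf b_not0) (negPf b_not1) => /esym b_i.
have b1_not1 : ~~ modulo_e 1 (b - 1).
  apply/negP => b1; move: h1; rewrite swap01_near1 // b_i => h1.
  by apply: (absurd_eq n1 h1); ring.
have [b0|b2_not0] := boolP (modulo_e 0 (b - 2%:R)).
  case/negP: b1_not1; rewrite -(modulo_e_shift 1) subrK.
  by rewrite -(modulo_e_shift 2%:R) subrK add0r in b0.
have [b1|b2_not1] := boolP (modulo_e 1 (b - 2%:R)).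
  move: h2; rewrite swap01_near1 // b_i => h2; split.
    have -> : 4%:R = (2%:R + i) - (1 + i - 2%:R - 1) :> 'Z_N by ring.
    by rewrite {1}h2 subrr.
  by move: b1; rewrite -(modulo_e_shift 1) b_i; congr modulo_e; ring.
exfalso; move: h2; rewrite /swap01 (negPf b2_not0) (negPf b2_not1) b_i => h2.
by apply: (absurd_eq n3 h2); ring.
Qed.

End SwapIndices.

(** * Residues modulo N and one-point extensions of finite sets *)

Lemma natr_Zp_inj N (k l : nat) : (1 < N)%N -> (k < N)%N -> (l < N)%N ->
  (k%:R = l%:R :> 'Z_N)%R -> k = l.
Proof.
by move=> N1 kN lN /(congr1 val) /=; rewrite !val_Zp_nat // !modn_small.
Qed.

Lemma ord_natr_Zp N (k : 'Z_N) :
  (1 < N)%N -> exists2 l, (l < N)%N & (k = l%:R)%R.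
Proof.
move=> N1; exists k; last by rewrite natr_Zp.
by have := ltn_ord k; rewrite [X in (_ < X)%N]Zp_cast.
Qed.

(** Three different extensions would need three different added points. This form of the diamond
    property serves twice: for the uniqueness in [sigma] and for the faces of the reverse flag. *)
Lemma two_extensions (V : finType) (A X Y Z : {set V}) (P : pred {set V}) :
  (#|[set u | (u \notin A) && P (u |: A)]| <= 2)%N ->
  A \subset X -> A \subset Y -> A \subset Z ->
  #|X| = #|A|.+1 -> #|Y| = #|A|.+1 -> #|Z| = #|A|.+1 ->
  P X -> P Y -> P Z -> X != Y -> X != Z -> Y = Z.
Proof.
move=> le2 AX AY AZ cX cY cZ PX PY PZ XY XZ.
have ext (B : {set V}) : A \subset B -> #|B| = #|A|.+1 ->
    exists2 u, u \notin A & B = u |: A.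
  move=> AB cB; have /card_gt0P[u] : (0 < #|B :\: A|)%N.
    by rewrite cardsD (setIidPr AB) cB subSnn.
  rewrite inE => /andP[uA uB]; exists u => //; apply/esym/eqP.
  by rewrite eqEcard subUset sub1set uB AB cardsU1 uA cB leqnn.
have [x xA eX] := ext _ AX cX; have [y yA eY] := ext _ AY cY.
have [z zA eZ] := ext _ AZ cZ; subst X Y Z.
congr (_ |: _); apply/eqP/negPn/negP => yz.
have xy : x != y by apply: contraNneq XY => ->.
have xz : x != z by apply: contraNneq XZ => ->.
suff : (2 < #|[set u | (u \notin A) && P (u |: A)]|)%N by rewrite ltnNge le2.
have <- : #|[set x; y; z]| = 3%N.
  by rewrite -setUA cardsU1 cards2 !inE negb_or xy xz yz.
by apply/subset_leq_card/subsetP => u; rewrite !inE -orbA => /or3P[]/eqP ->;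
  apply/andP.
Qed.

(** * Flags of a simplicial polytope as cyclic enumerations of its vertices *)

Section SimplicialComplex.
Local Open Scope ring_scope.
Variables (R : realFieldType) (n : nat) (V : finType) (p : V -> 'rV[R]_n).
Variables (d N : nat) (e : 'Z_N) (ok : pred {set V}) (neg : V -> V).

(* Every vertex occurs once along a zigzag; [neg] is the identity for the
   simplex and the antipode for the cross-polytope. *)
Definition equivariant (w : 'Z_N -> V) :=
  injective w /\ forall k, w (k + e) = neg (w k).

Hypothesis d_gt2 : (2 < d)%N.
Hypothesis d_ltN : (d < N)%N.
Hypothesis ee0 : e + e = 0.
(** The bound keeps d + 1 from wrapping around to 0, so that the transposition (d d+1) fixes the
    indices below [d]. *)
Hypothesis e_alt : e = 0 \/ e = d%:R /\ (d.+1 < N)%N.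
(** The boundary complex is described by [ok]: its nonempty members are the proper faces, all of
    them simplices, and a ridge lies in at most two facets. *)
Hypothesis okS : forall A B : {set V}, A \subset B -> ok B -> ok A.
Hypothesis face_ok : forall F, F != set0 -> F != [set: V] -> face p F -> ok F.
Hypothesis ok_face : forall F, F != set0 -> ok F ->
  [/\ face p F, F != [set: V] & face_dim p F = #|F|.-1].
Hypothesis equivariant_ok : forall w, equivariant w ->
  ok [set w k%:R | k : 'I_d].
Hypothesis ok_equivariant : forall v : 'I_d -> V, injective v ->
  ok [set v k | k : 'I_d] ->
  exists2 w, equivariant w & forall k : 'I_d, w k%:R = v k.
Hypothesis equivariant_eq : forall w w', equivariant w -> equivariant w' ->
  (forall k : 'I_d, w k%:R = w' k%:R) -> w =1 w'.
Hypothesis ok_thin : forall A : {set V}, #|A| = d.-1 ->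
  (#|[set u | (u \notin A) && ok (u |: A)]| <= 2)%N.

Implicit Types (f g h : flag p d) (w : 'Z_N -> V).

Let N_gt1 : (1 < N)%N. Proof. by lia. Qed.

(** An arc of consecutive vertices; the start varies because [T] and the reversal produce arcs that
    do not begin at 0. *)
Definition seg w (a : 'Z_N) m : {set V} := [set w (a + k%:R) | k : 'I_m].

Lemma segP w a m u :
  reflect (exists2 k, (k < m)%N & u = w (a + k%:R)) (u \in seg w a m).
Proof.
apply: (iffP imsetP) => [[k _ ->]|[k km ->]]; first by exists k.
by exists (Ordinal km).
Qed.

Lemma sub_seg w a b c m m' : a = b + c%:R -> (c + m <= m')%N ->
  seg w a m \subset seg w b m'.
Proof.
move=> -> cm; apply/subsetP => _ /segP[k km ->]; apply/segP.
by exists (c + k)%N; rewrite ?natrD ?addrA //; lia.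
Qed.

Lemma card_seg w a m : injective w -> (m <= N)%N -> #|seg w a m| = m.
Proof.
move=> w_inj mN; rewrite card_imset ?card_ord // => i j /w_inj/addrI/natr_Zp_inj.
by move=> /(_ N_gt1) ij; apply/val_inj/ij; apply: leq_trans mN.
Qed.

Lemma seg_neq w m : injective w -> (0 < m < N)%N -> seg w 0 m != seg w 1 m.
Proof.
move=> w_inj /andP[m0 mN]; apply/eqP => eq_seg.
have : w 0 \in seg w 1 m.
  by rewrite -eq_seg; apply/segP; exists 0%N; rewrite ?addr0.
move=> /segP[k km /w_inj /esym/eqP]; rewrite -mulrS.
by move=> /eqP/(@natr_Zp_inj _ _ 0 N_gt1); lia.
Qed.

Lemma seg_shift w a b m : seg (fun k => w (k + b)) a m = seg w (a + b) m.
Proof. by apply: eq_imset => k /=; rewrite addrAC. Qed.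

Lemma equivariant_shift w a : equivariant w -> equivariant (fun k => w (k + a)).
Proof.
case=> w_inj w_e; split=> [i j /w_inj/addIr // | k].
by rewrite addrAC w_e.
Qed.

Lemma seg_ok w a m : equivariant w -> (m <= d)%N -> ok (seg w a m).
Proof.
move=> /(equivariant_shift a)/equivariant_ok ok_d md; apply: okS ok_d.
apply/subsetP => _ /segP[k km ->]; apply/imsetP.
by exists (Ordinal (leq_trans km md)); rewrite //= addrC.
Qed.

Lemma flag_ok f (i : 'I_d) : ok (val f i) /\ #|val f i| = i.+1.
Proof.
have /asboolP[/(_ i)[Ff f0 fT fdim] _] := valP f.
have okf := face_ok f0 fT Ff; split=> //.
have [_ _] := ok_face f0 okf; rewrite fdim => ->.
by rewrite prednK // card_gt0.
Qed.

Lemma flag_subset f (i j : 'I_d) : (i <= j)%N -> val f i \subset val f j.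
Proof.
rewrite leq_eqVlt => /predU1P[/val_inj -> // | ij].
by have /asboolP[_ /(_ _ _ ij)/proper_sub] := valP f.
Qed.

Lemma ok_flag (F : nat -> {set V}) :
  (forall i, (i < d)%N -> ok (F i) /\ #|F i| = i.+1) ->
  (forall i j, (i < j < d)%N -> F i \subset F j) ->
  exists f, forall i : 'I_d, val f i = F i.
Proof.
move=> Fok Fsub; have FP : `[< is_flag p [ffun i : 'I_d => F i] >].
  apply/asboolP; split=> [i|i j ij]; rewrite !ffunE.
    have [okFi cFi] := Fok _ (ltn_ord i).
    have Fi0 : F i != set0 by rewrite -card_gt0 cFi.
    by have [? ? ->] := ok_face Fi0 okFi; split=> //; rewrite cFi.
  rewrite properEcard Fsub ?ij ?ltn_ord //.
  by have [_ ->] := Fok _ (ltn_ord i); have [_ ->] := Fok _ (ltn_ord j).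
by exists (exist (fun F => is_true `[< is_flag p F >]) _ FP) => i; rewrite /= ffunE.
Qed.

(** The face that precedes [val f i]; written as a union, it is empty at index 0, in agreement with
    the convention for F_0. *)
Definition below f (i : 'I_d) : {set V} :=
  \bigcup_(j : 'I_d | (j < i)%N) val f j.

Lemma below_subset f i : below f i \subset val f i.
Proof. by apply/bigcupsP => j /ltnW; apply: flag_subset. Qed.

Lemma card_below f i : #|below f i| = i.
Proof.
case: i => [[|i] id]; rewrite /below.
  by rewrite big_pred0 ?cards0.
have [_ card_i] := flag_ok f (Ordinal (ltnW id)).
apply: etrans card_i; apply/eq_card/subset_eqP/andP; split; last exact: bigcup_sup.
by apply/bigcupsP => j ji; apply: flag_subset.
Qed.

(** The face at [i] is a one-vertex extension of the face below it, and at most two such extensions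
    are compatible with the rest of the flag. *)
Lemma flag_diamond f g h i :
  (forall j, j != i -> val g j = val f j) ->
  (forall j, j != i -> val h j = val f j) -> g != f -> h != f -> g = h.
Proof.
move=> gf hf g_neq h_neq.
have neq_i (k : flag p d) : (forall j, j != i -> val k j = val f j) -> k != f ->
    val f i != val k i.
  move=> kf; apply: contraNneq => fk; apply/eqP/val_inj/ffunP => j.
  by have [->|/kf] := eqVneq j i.
have below_eq (k : flag p d) : (forall j, j != i -> val k j = val f j) ->
    below k i = below f i.
  by move=> kf; apply: eq_bigr => j ji; apply: kf; rewrite -val_eqE ltn_eqF.
have below_sub (k : flag p d) : (forall j, j != i -> val k j = val f j) ->
    below f i \subset val k i.
  by move=> kf; rewrite -(below_eq k kf) below_subset.
suff gh : val g i = val h i.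
  apply/val_inj/ffunP => j; have [->//|ji] := eqVneq j i.
  by rewrite [LHS]gf // [RHS]hf.
(* The constraint from above: inclusion in the next face of the flag or, for the top face,
   membership in the complex. *)
pose P := if insub i.+1 is Some j
          then fun A : {set V} => A \subset val f (j : 'I_d) else ok.
have P_i (k : flag p d) : (forall j, j != i -> val k j = val f j) ->
    P (val k i).
  move=> kf; rewrite /P; case: insubP => [j _ ji|_]; last exact: (flag_ok k i).1.
  rewrite -(kf j) ?flag_subset ?ji //.
  by rewrite -val_eqE /= ji gtn_eqF.
apply: (@two_extensions _ (below f i) (val f i) _ _ P);
  rewrite ?card_below ?(flag_ok _ i).2 ?below_sub ?P_i ?neq_i //.
(* The next face has just two vertices outside [below f i]; at the top the bound is [ok_thin]. *)
rewrite /P; case: insubP => [j _ ji|].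
  have cD : #|val f j :\: below f i| = 2%N.
    rewrite cardsD (setIidPr _) ?card_below ?(flag_ok f j).2 ?ji; first by lia.
    by apply/(subset_trans (below_subset f i))/flag_subset; rewrite ji.
  rewrite -cD; apply/subset_leq_card/subsetP => u.
  by rewrite !inE subUset sub1set => /and3P[-> ->].
rewrite -leqNgt => di; apply: ok_thin; rewrite card_below.
by have := ltn_ord i; lia.
Qed.

(** The existence of [g] rules out the default value of [sigma], and [flag_diamond] identifies the
    flag that is picked. *)
Lemma sigma_eq f g (i : 'I_d) :
  (forall j, j != i -> val g j = val f j) -> g != f -> sigma i.+1 f = g.
Proof.
move=> gf g_neq; rewrite /sigma; case: pickP => [h|/(_ g)] /=.
  move=> /andP[h_neq /forallP hf]; apply: (@flag_diamond f h g i) => // j ji.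
  by apply/eqP/(implyP (hf j)); rewrite eqSS.
move=> /negbT; rewrite g_neq /=; case/forallP => j; apply/implyP; rewrite eqSS.
by move=> ji; apply/eqP/gf.
Qed.

Definition codes w f :=
  equivariant w /\ forall i : 'I_d, val f i = seg w 0 i.+1.

(** The vertices that each face adds to the previous one order the top facet, and [ok_equivariant]
    extends this ordering to Z/N. *)
Lemma codes_ex f : exists w, codes w f.
Proof.
have /choice[v vP] (i : 'I_d) :
    exists u, (u \in val f i) && (u \notin below f i).
  have /card_gt0P[u] : (0 < #|val f i :\: below f i|)%N.
    rewrite cardsD (setIidPr (below_subset f i)) card_below (flag_ok f i).2.
    by rewrite subSnn.
  by rewrite inE andbC => uP; exists u.
have v_neq (i j : 'I_d) : (i < j)%N -> v i <> v j.
  move=> ij vij; have /andP[_ /negP[]] := vP j; rewrite -vij.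
  by apply/bigcupP; exists i => //; case/andP: (vP i).
have v_inj : injective v.
  by move=> i j vij; case: (ltngtP i j) => [/v_neq|/v_neq/nesym|/val_inj].
have v_seg (w : 'Z_N -> V) : (forall k : 'I_d, w k%:R = v k) -> forall i : 'I_d,
    val f i = seg w 0 i.+1.
  move=> wv i; apply/esym/eqP; rewrite eqEcard (flag_ok f i).2.
  have lt_d (k : 'I_i.+1) : (k < d)%N := leq_trans (ltn_ord k) (ltn_ord i).
  apply/andP; split.
    apply/subsetP => _ /imsetP[k _ ->]; rewrite add0r (wv (Ordinal (lt_d k))).
    apply: (subsetP (@flag_subset f (Ordinal (lt_d k)) i _)).
      by rewrite -ltnS /=.
    by have /andP[] := vP (Ordinal (lt_d k)).
  rewrite card_in_imset ?card_ord // => k l _ _; rewrite !add0r.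
  rewrite (wv (Ordinal (lt_d k))) (wv (Ordinal (lt_d l))) => /v_inj/(congr1 val) kl.
  exact: val_inj.
have [|w w_eq wv] := ok_equivariant v_inj; last by exists w; split=> //; apply: v_seg.
have lt_d : (d.-1 < d)%N by lia.
apply: okS (flag_ok f (Ordinal lt_d)).1; apply/subsetP => _ /imsetP[k _ ->].
apply: (subsetP (@flag_subset f k (Ordinal lt_d) _)).
  by have := ltn_ord k; rewrite /=; lia.
by have /andP[] := vP k.
Qed.

(** The indices below [d] suffice. If w k were w' l with l < k, it would lie in the common arc of
    length k and equal w m for some m < k. *)
Lemma codes_unique w w' f : codes w f -> codes w' f -> w =1 w'.
Proof.
move=> [w_eq wf] [w_eq' wf']; apply: equivariant_eq => // k.
have segk m : (m <= d)%N -> seg w 0 m = seg w' 0 m.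
  case: m => [|m] md; last by rewrite -(wf (Ordinal md)) wf'.
  by apply/setP => u; apply/segP/segP => -[].
have : w k%:R \in seg w' 0 k.+1.
  by rewrite -segk //; apply/segP; exists k; rewrite ?add0r.
case/segP => l; rewrite add0r ltnS leq_eqVlt => /predU1P[-> //|lk wl].
have : w k%:R \in seg w 0 k.
  by rewrite segk 1?ltnW //; apply/segP; exists l; rewrite ?add0r.
case/segP => m mk; rewrite add0r => /(proj1 w_eq)/natr_Zp_inj.
by have := ltn_ord k => kd /(_ N_gt1); lia.
Qed.

Lemma codes_flag w : equivariant w -> exists f, codes w f.
Proof.
move=> w_eq; have [||f fP] := @ok_flag (fun i => seg w 0 i.+1).
- move=> i id; split; first exact: seg_ok.
  by rewrite card_seg //; [case: w_eq | lia].
- by move=> i j /andP[ij jd]; apply: (@sub_seg _ _ _ 0); rewrite ?addr0 //; lia.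
by exists f.
Qed.

(** The step from m to m + 1 replaces {w_0, ..., w_m} by {w_1, ..., w_(m+1)}; both lie between the
    shifted faces below and the unchanged faces above. *)
Lemma codes_foldl_sigma w f m : codes w f -> (m <= d)%N -> forall i : 'I_d,
  val (foldl (fun g i => sigma i g) f (iota 1 m)) i =
  if (i < m)%N then seg w 1 i.+1 else seg w 0 i.+1.
Proof.
move=> [w_eq wf]; have w_inj := proj1 w_eq.
elim: m => [|m IHm] md i; first by rewrite wf.
have -> : iota 1 m.+1 = rcons (iota 1 m) m.+1.
  by rewrite -[X in iota _ X]addn1 iotaD cats1.
rewrite foldl_rcons.
pose F i := if (i < m.+1)%N then seg w 1 i.+1 else seg w 0 i.+1.
have [||g gF] := @ok_flag F; rewrite /F.
- move=> j jd; case: ifP => _; split; rewrite ?seg_ok ?card_seg //; lia.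
- move=> j k jk; case: ifP => jm; case: ifP => km; last 1 first.
  + by apply: (@sub_seg _ _ _ 0); rewrite ?addr0 //; lia.
  + by apply: (@sub_seg _ _ _ 0); rewrite ?addr0 //; lia.
  + by apply: (@sub_seg _ _ _ 1); rewrite ?add0r //; lia.
  by lia.
rewrite (@sigma_eq _ g (Ordinal md)) ?gF // => [j jm|].
  rewrite gF /F IHm ?(ltnW md) // ltnS leq_eqVlt.
  by rewrite -val_eqE in jm; rewrite (negPf jm).
apply/eqP => /(congr1 (fun g => val g (Ordinal md))); rewrite gF /F IHm ?(ltnW md) //=.
rewrite ltnn ltnSn => /eqP; rewrite eq_sym; apply/negP/seg_neq => //; lia.
Qed.

Lemma codes_T w f : codes w f -> codes (fun k => w (k + 1)) (T f).
Proof.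
move=> wf; have [w_eq _] := wf; split=> [|i]; first exact: equivariant_shift.
by rewrite /T (codes_foldl_sigma wf) // ltn_ord seg_shift add0r.
Qed.

Let n1 : 1%:R != 0 :> 'Z_N.
Proof. by apply/eqP => /(@natr_Zp_inj _ _ 0 N_gt1); lia. Qed.

Let e1 : e != 1.
Proof.
case: e_alt => [->|[-> _]]; first by rewrite eq_sym n1.
by apply/eqP => /(@natr_Zp_inj _ _ 1 N_gt1); lia.
Qed.

(** The case m = 1 of [codes_foldl_sigma] shows that only F_1 changes, to {w_1}; the longer initial
    arcs are invariant under the swap. *)
Lemma codes_sigma1 w f :
  codes w f -> codes (fun k => w (swap01 e k)) (sigma 1 f).
Proof.
move=> wf; have [[w_inj w_e] _] := wf.
have ws_inj : injective (fun k => w (swap01 e k)).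
  by move=> i j /w_inj/(can_inj (swap01K ee0 n1 e1)).
have swap0 := @swap01_0 _ e; have swap1 := swap01_1 ee0 n1 e1.
split=> [|i].
  by split=> // k; rewrite swap01_addr.
have := @codes_foldl_sigma _ _ 1 wf (ltnW (ltnW d_gt2)) i; rewrite /= => ->.
case: i => [[|i] /= id].
  apply/setP => u; apply/segP/segP => -[[|k] // _ ->]; exists 0%N => //;
  by rewrite ?addr0 ?swap0.
apply/esym/eqP; rewrite eqEcard !card_seg ?leqnn ?andbT //; try lia.
apply/subsetP => _ /segP[[|[|k]] ki ->]; apply/segP; rewrite add0r.
- by exists 1%N; rewrite ?swap0 ?add0r.
- by exists 0%N; rewrite ?swap1 ?add0r.
(* Indices from 2 to d - 1 are fixed: [e] and [e + 1] are 0 and 1, or d and d + 1. *)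
exists k.+2 => //; rewrite add0r; congr w; rewrite /swap01 /modulo_e !add0r.
have k_neq l : (l < N)%N -> k.+2 != l -> (k.+2%:R == l%:R :> 'Z_N) = false.
  by move=> lN kl; apply: contraNF kl => /eqP/natr_Zp_inj -> //; lia.
have N_gt0 : (0 < N)%N := ltnW N_gt1.
rewrite (k_neq 0%N N_gt0) // (k_neq 1%N N_gt1) //=.
case: e_alt => [->|[-> dN]].
  by rewrite (k_neq 0%N N_gt0) // addr0 (k_neq 1%N N_gt1).
by rewrite -(natrD _ 1) !k_neq //; lia.
Qed.

(** Induction on the column [j], then on the row [i]. The face [x m j.+1] adds one vertex to the arc
    below it inside [x m.+1 j], which has just two more vertices than that arc; one choice gives
    [x m j], which is excluded. *)
Lemma reverse_family_seg w f (x : nat -> nat -> {set V}) :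
  codes w f -> reverse_family f x ->
  forall i j, (i + j < d)%N -> x i j = seg w j%:R i.+1.
Proof.
move=> [w_eq wf] [x0 xface xS xS' x_neq]; have w_inj := proj1 w_eq.
move=> i j; elim: j i => [|j IHj] i.
  by rewrite addn0 => id; rewrite (x0 (Ordinal id)) wf.
suff step m : (m + j.+1 < d)%N -> seg w j.+1%:R m \subset x m j.+1 ->
    x m j.+1 = seg w j.+1%:R m.+1.
  elim: i => [|i IHi] ij; apply: step => //.
    by apply/subsetP => u /segP[].
  by rewrite -IHi ?xS //; lia.
move=> mj sub_x; have [xf xn0 xd] := xface _ _ mj.
have jS : j.+1%:R = j%:R + 1%:R :> 'Z_N by rewrite -natrD addn1.
have xX : x m j = seg w j%:R m.+1 by apply: IHj; lia.
have xB : x m.+1 j = seg w j%:R m.+2 by apply: IHj; lia.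
have x_okS : x m j.+1 \subset x m.+1 j by apply: xS'.
have x_card : #|x m j.+1| = m.+1.
  have x_ok : ok (x m j.+1) by apply: okS x_okS _; rewrite xB seg_ok //; lia.
  have [_ _] := ok_face xn0 x_ok; rewrite xd => m_eq.
  by rewrite -[LHS]prednK ?card_gt0 // -m_eq.
have segX : seg w j%:R m.+1 != seg w j.+1%:R m.+1.
  have := seg_shift w 0 j%:R m.+1; have := seg_shift w 1 j%:R m.+1.
  rewrite add0r -mulrS => <- <-; apply: seg_neq; last by lia.
  by move=> k l /w_inj/addIr.
have cA : #|seg w j.+1%:R m| = m by rewrite card_seg //; lia.
have sAB : seg w j.+1%:R m \subset seg w j%:R m.+2 by apply: sub_seg jS _; lia.
apply: (@two_extensions _ (seg w j.+1%:R m) (seg w j%:R m.+1) _ _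
          (fun F => F \subset seg w j%:R m.+2)) => //.
- have <- : #|seg w j%:R m.+2 :\: seg w j.+1%:R m| = 2%N.
    by rewrite cardsD (setIidPr sAB) cA card_seg //; lia.
  apply/subset_leq_card/subsetP => u.
  by rewrite !inE subUset sub1set => /and3P[-> ->].
- by apply: sub_seg jS _; lia.
- by apply: (@sub_seg _ _ _ 0); rewrite ?addr0.
- by rewrite cA card_seg //; lia.
- by rewrite cA.
- by rewrite cA card_seg //; lia.
- by apply: (@sub_seg _ _ _ 0); rewrite ?addr0.
- by rewrite -xB.
- exact: sub_seg jS _.
- by rewrite -xX eq_sym x_neq.
Qed.

(** The reverse flag consists of the final arcs {w_(d-1-i), ..., w_(d-1)} of the top facet, the
    initial arcs of [w] read backwards from d - 1. *)
Lemma codes_rev w f :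
  codes w f -> codes (fun k => w (d.-1%:R - k)) (flag_rev f).
Proof.
move=> wf; have [w_eq wfE] := wf; have w_inj := proj1 w_eq.
pose x i j := seg w j%:R i.+1.
have xfam : reverse_family f x.
  split=> [i|i j ij|i j ij|i j ij|i j ij]; rewrite /x.
  - by rewrite wfE.
  - have s0 : seg w j%:R i.+1 != set0 by rewrite -card_gt0 card_seg //; lia.
    have [|? _ ->] := ok_face s0; first by apply: seg_ok => //; lia.
    by rewrite card_seg //; lia.
  - by apply: (@sub_seg _ _ _ 0); rewrite ?addr0.
  - by apply: (@sub_seg _ _ _ 1); rewrite // -natrD addn1.
  have := seg_shift w 0 j%:R i.+1; have := seg_shift w 1 j%:R i.+1.
  rewrite add0r -mulrS eq_sym => <- <-; apply: seg_neq; last by lia.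
  by move=> k l /w_inj/addIr.
have [||g gP] := @ok_flag (fun i => x i (d.-1 - i)%N).
- by move=> i id; rewrite /x card_seg ?seg_ok //; lia.
- move=> i j ij; apply: (@sub_seg _ _ _ (j - i)); last by lia.
  by rewrite -natrD; congr _%:R; lia.
have rev_sub (i : 'I_d) : rev_ord i = (d.-1 - i)%N :> nat by rewrite /=; lia.
have g_rev : is_reverse f g by exists x => // i; rewrite gP rev_sub.
have -> : flag_rev f = g.
  rewrite /flag_rev; case: pickP => [h /asboolP[y yfam hy]|/(_ g)] /=.
    apply/val_inj/ffunP => i; rewrite hy gP rev_sub.
    by rewrite (reverse_family_seg wf yfam) //; have := ltn_ord i; lia.
  by move=> /negP[]; apply/asboolP.
split=> [|i].
  (* Equivariance survives the reflection because - e = e. *)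
  split=> [k l /w_inj/addrI/oppr_inj //|k].
  have [_ <-] := w_eq; congr w.
  by rewrite opprD addrA; congr (_ + _); apply/eqP; rewrite eq_sym -addr_eq0 ee0.
have id := ltn_ord i; rewrite gP; apply/eqP; rewrite eqEcard !card_seg //; try lia.
  rewrite leqnn andbT; apply/subsetP => _ /segP[k ki ->]; apply/segP.
  exists (i - k)%N; first by lia.
  rewrite add0r -natrD; congr w; apply/eqP; rewrite eq_sym subr_eq -natrD.
  by apply/eqP; congr _%:R; lia.
by move=> k l /w_inj/addrI/oppr_inj.
Qed.

(** Codes are unique, so each transformation rule holds as soon as both sides code the same flag. *)
Lemma simplicial_encoding : exists enc : flag p d -> 'Z_N -> V,
  [/\ forall f g, enc f =1 enc g -> f = g,
      forall f, injective (enc f),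
      forall f k, enc (T f) k = enc f (k + 1),
      forall f k, enc (flag_rev f) k = enc f (d.-1%:R - k)
    & forall f k, enc (sigma 1 f) k = enc f (swap01 e k)].
Proof.
have [enc encP] := choice codes_ex; exists enc; split=> [f g eq_fg|f|f|f|f].
- apply/val_inj/ffunP => i; rewrite (encP f).2 (encP g).2.
  by apply: eq_imset => k; rewrite eq_fg.
- by have [[]] := encP f.
- exact: codes_unique (encP _) (codes_T (encP f)).
- exact: codes_unique (encP _) (codes_rev (encP f)).
exact: codes_unique (encP _) (codes_sigma1 (encP f)).
Qed.

(** Restricting codes to the indices below [d] identifies flags with ordered facets. *)
Lemma card_simplicial_flags : #|{: flag p d}| =
  #|[set v : {ffun 'I_d -> V} | injectiveb v && ok [set v k | k : 'I_d]]|.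
Proof.
have [enc encP] := choice codes_ex.
pose F f := [ffun k : 'I_d => enc f k%:R].
have lt_N (k : 'I_d) : (k < N)%N by apply: ltn_trans d_ltN.
have F_inj : injective F.
  move=> f g /ffunP eq_fg; apply/val_inj/ffunP => i.
  rewrite (encP f).2 (encP g).2; apply: eq_imset => k; apply: equivariant_eq.
  - exact: (encP f).1.
  - exact: (encP g).1.
  by move=> l; have := eq_fg l; rewrite !ffunE.
rewrite -(card_imset _ F_inj); apply: eq_card => v; rewrite inE.
apply/imsetP/andP => [[f _ ->]|[/injectiveP v_inj okv]].
  have w_eq := (encP f).1; split.
    apply/injectiveP => i j; rewrite !ffunE => /(proj1 w_eq)/natr_Zp_inj ij.
    by apply/val_inj/ij.
  by under eq_imset do rewrite ffunE; apply: equivariant_ok.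
have [w w_eq wv] := ok_equivariant v_inj okv; have [f wf] := codes_flag w_eq.
exists f => //; apply/ffunP => k; rewrite ffunE -wv.
exact: codes_unique wf (encP f) _.
Qed.

Let n2 : 2%:R != 0 :> 'Z_N.
Proof. by apply/eqP => /(@natr_Zp_inj _ _ 0 N_gt1); lia. Qed.

Let n3 : 3%:R != 0 :> 'Z_N.
Proof. by apply/eqP => /(@natr_Zp_inj _ _ 0 N_gt1); lia. Qed.

Let e2 : e != 2%:R.
Proof.
case: e_alt => [->|[-> _]]; first by rewrite eq_sym n2.
by apply/eqP => /(@natr_Zp_inj _ _ 2 N_gt1); lia.
Qed.

Lemma simplicial_z_vector m :
  (#|{: flag p d}| = m * (2 * N))%N -> has_z_vector p d N m.
Proof.
have [enc [enc_eq enc_inj encT enc_rev enc_sigma]] := simplicial_encoding.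
apply: (cyclic_z_vector N_gt1 n2 enc_eq enc_inj encT enc_rev enc_sigma).
  exact: swap01_not_shift.
exact: swap01_not_reflection.
Qed.

Lemma simplicial_intersection_vector a b m :
  #|[set 0; e]| = a -> #|reflection_meets (swap01 e)| = b ->
  (m * (a + b) = N)%N ->
  forall Z, Z \in zigzags p d ->
    has_intersection_vector Z (minn a b, maxn a b) m.
Proof.
have [enc [enc_eq enc_inj encT enc_rev enc_sigma]] := simplicial_encoding.
rewrite -shift_meets_swap01 //.
apply: (cyclic_intersection_vector N_gt1 n2 enc_eq enc_inj encT enc_rev enc_sigma).
  exact: swap01_not_shift.
exact: swap01_not_reflection.
Qed.

Lemma reflection_meets_swap01_eq0 : (4 < N)%N ->
  #|reflection_meets (swap01 e)| = 0%N.
Proof.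
move=> N_gt4; apply: eq_card0 => i; apply/negP.
move=> /(reflection_meets_swap01 ee0 n1 n2 n3 e1 e2)[].
by move=> /(@natr_Zp_inj _ _ 0 N_gt1); lia.
Qed.

End SimplicialComplex.

(** * Dimension of a face whose vertices lie on distinct coordinate axes *)

Section Rank.
Local Open Scope ring_scope.
Variables (R : realFieldType) (n : nat) (V : finType) (p : V -> 'rV[R]_n).

Lemma mxrank_sum_rV_le (A : {pred V}) (q : V -> 'rV[R]_n) :
  (\rank (\sum_(v in A) <<q v>>)%MS <= #|A|)%N.
Proof.
rewrite -sum1_card; elim/big_rec2: _ => [|v k B _ leBk]; first by rewrite mxrank0.
apply: leq_trans (mxrank_adds_leqif _ _).1 _; apply: leq_add leBk.
by rewrite mxrank_gen rank_leq_row.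
Qed.

Lemma face_dim_axes (axis : V -> 'I_n) (F : {set V}) :
  (forall v, v \in F -> (p v :=: (delta_mx 0 (axis v) : 'rV[R]_n))%MS) ->
  {in F &, injective axis} -> F != set0 -> face_dim p F = #|F|.-1.
Proof.
move=> p_axis axis_inj /set0Pn[v0 v0F]; rewrite /face_dim.
set S := (X in \rank X).
have S_diff u v : u \in F -> v \in F -> (p u - p v <= S)%MS.
  move=> uF vF; apply: (sumsmx_sup u) => //; apply: (sumsmx_sup v) => //.
  by rewrite genmxE.
have rank_F : \rank (\sum_(v in F) <<p v>>)%MS = #|F|.
  rewrite (eq_bigr (fun v => <<delta_mx 0 (axis v) : 'rV[R]_n>>%MS)); last first.
    by move=> v vF; apply/eq_genmx/p_axis.
  rewrite (mxdirectP (mxdirect_delta _ axis_inj)) /= -sum1_card.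
  by apply: eq_bigr => v _; rewrite mxrank_gen mxrank_delta.
apply/eqP; rewrite eqn_leq; apply/andP; split.
  (* Upper bound: the differences with the base point [v0] generate all differences. *)
  have -> : #|F|.-1 = #|[predD1 F & v0]| by rewrite (cardD1 v0) v0F.
  apply: leq_trans (mxrank_sum_rV_le _ (fun v => p v - p v0)).
  have sub_v0 u : u \in F ->
      (p u - p v0 <= \sum_(v in [predD1 F & v0]) <<p v - p v0>>)%MS.
    move=> uF; have [->|uv0] := eqVneq u v0; first by rewrite subrr sub0mx.
    by apply: (sumsmx_sup u); rewrite ?genmxE // !inE uv0.
  apply/mxrankS/sumsmx_subP => u uF; apply/sumsmx_subP => v vF.
  rewrite genmxE -[p u](subrK (p v0)) -addrA -(opprB (p v)).
  by rewrite addmx_sub ?eqmx_opp ?sub_v0.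
(* Lower bound: the differences together with [p v0] span the independent vectors [p v]. *)
suff : (#|F| <= \rank S + 1)%N by lia.
rewrite -rank_F.
apply: leq_trans (mxrankS _) (leq_trans (mxrank_adds_leqif S (p v0)).1 _).
  apply/sumsmx_subP => v vF; rewrite genmxE -[p v](subrK (p v0)).
  by apply: addmx_sub_adds; rewrite ?S_diff.
by rewrite leq_add2l rank_leq_row.
Qed.

End Rank.

(** * The simplex *)

Section Simplex.
Local Open Scope ring_scope.

(** The general bound leaves only i = 2, which the reflection k -> 3 - k attains. *)
Lemma reflection_meets_tetrahedron :
  (reflection_meets (swap01 (0 : 'Z_4)) = [set 2%:R])%R.
Proof.
apply/setP => i; rewrite in_set1; apply/idP/eqP => [/reflection_meets_swap01[]|->].
  all: rewrite ?addr0 //.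
  by move=> _; rewrite /modulo_e addr0 orbb => /eqP.
rewrite inE; apply/existsP; exists 3%:R; apply/forallP.
by case=> -[|[|[|[|]]]].
Qed.

Variables (R : realFieldType) (d : nat).
Hypothesis d_gt2 : (2 < d)%N.

Let N_gt1 : (1 < d.+1)%N. Proof. by lia. Qed.
Let ok (F : {set 'I_d.+1}) := F != setT.

Lemma simplex_okS (A B : {set 'I_d.+1}) : A \subset B -> ok B -> ok A.
Proof. by move=> AB; apply: contra => /eqP AT; rewrite -subTset -AT. Qed.

Lemma simplex_ok_face F : F != set0 -> ok F ->
  [/\ face (@simplex R d) F, F != setT & face_dim (@simplex R d) F = #|F|.-1].
Proof.
move=> F0 okF; split=> //; last first.
  by apply: (face_dim_axes (axis := id)) => //; apply: in2W.
(* The sum of the coordinates indexed by [F] is 1 at the vertices in [F] and 0 at the others. *)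
exists (\col_i (i \in F)%:R), 1; split=> v.
  by rewrite -rowE !mxE; case: (v \in F); rewrite ?ler01.
by rewrite -rowE !mxE; case: (v \in F); rewrite ?eqxx // eq_sym oner_eq0.
Qed.

Lemma imset_ord_neqT (f : 'I_d -> 'I_d.+1) : ok [set f k | k : 'I_d].
Proof.
apply/eqP => fT; suff : (#|[set: 'I_d.+1]| <= d)%N by rewrite cardsT card_ord ltnn.
by rewrite -fT; apply: leq_trans (leq_imset_card _ _) _; rewrite card_ord.
Qed.

Lemma simplex_equivariant_ok w : @equivariant 'I_d.+1 d.+1 0 id w ->
  ok [set w k%:R | k : 'I_d].
Proof.
by move=> _; apply: imset_ord_neqT.
Qed.

Lemma simplex_ok_equivariant (v : 'I_d -> 'I_d.+1) : injective v ->
  ok [set v k | k : 'I_d] ->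
  exists2 w, @equivariant 'I_d.+1 d.+1 0 id w & forall k : 'I_d, w k%:R = v k.
Proof.
move=> v_inj; rewrite /ok eqEsubset subsetT /= => /subsetPn[u _ u_v].
have v_neq k : v k != u by apply: contraNneq u_v => <-; apply: imset_f.
(* Only the residue [d] falls outside ['I_d]; there the default is [u], the vertex that [v]
   misses. *)
exists (fun x : 'Z_(d.+1) => oapp v u (insub (x : nat))) => [|k].
  split=> [x y|k]; last by rewrite addr0.
  have le_d (z : 'Z_(d.+1)) : (val z <= d)%N.
    by rewrite -ltnS -[X in (_ < X)%N](Zp_cast N_gt1) ltn_ord.
  case: insubP => [i _ ix|]; case: insubP => [j _ jy|] /=.
  - by move=> /v_inj ij; apply: val_inj; rewrite /= -ix -jy ij.
  - by move=> _ /eqP; rewrite (negPf (v_neq i)).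
  - by move=> _ /esym/eqP; rewrite (negPf (v_neq j)).
  rewrite -!leqNgt => dy dx _; apply/val_inj/eqP; rewrite /= eqn_leq.
  by rewrite (leq_trans (le_d x)) // (leq_trans (le_d y)).
have kd := ltn_ord k.
rewrite val_Zp_nat // modn_small; last by apply: ltnW.
by rewrite valK.
Qed.

(** Two bijections that agree at all residues but one agree at the last one too. *)
Lemma simplex_equivariant_eq w w' :
  @equivariant 'I_d.+1 d.+1 0 id w -> @equivariant 'I_d.+1 d.+1 0 id w' ->
  (forall k : 'I_d, w k%:R = w' k%:R) -> w =1 w'.
Proof.
move=> [w_inj _] [w_inj' _] ww' x.
have eq_small y : (val y < d)%N -> w y = w' y.
  by move=> yd; have := ww' (Ordinal yd); rewrite natr_Zp.
have [xd|dx] := ltnP (val x) d; first exact: eq_small.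
have /codomP[y wx] : w x \in codom w'.
  by apply: inj_card_onto; rewrite // !card_ord Zp_cast.
have [yd|dy] := ltnP (val y) d.
  by move: wx; rewrite -eq_small // => /w_inj xy; move: dx; rewrite xy leqNgt yd.
rewrite wx; congr w'; apply/val_inj => /=.
have le_d (z : 'Z_(d.+1)) : (val z <= d)%N.
  by rewrite -ltnS -[X in (_ < X)%N](Zp_cast N_gt1) ltn_ord.
by have := le_d x; have := le_d y; move: dx dy => /=; lia.
Qed.

Lemma simplex_thin (A : {set 'I_d.+1}) : #|A| = d.-1 ->
  (#|[set u | (u \notin A) && ok (u |: A)]| <= 2)%N.
Proof.
move=> cA; have := cardsC A; rewrite cA card_ord => cC.
apply: (@leq_trans #|~: A|); last by lia.
by apply/subset_leq_card/subsetP => u; rewrite !inE => /andP[].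
Qed.

Let ee0 : 0 + 0 = 0 :> 'Z_(d.+1). Proof. exact: addr0. Qed.
Let e_alt : 0 = 0 :> 'Z_(d.+1) \/ 0 = d%:R :> 'Z_(d.+1) /\ (d.+1 < d.+1)%N.
Proof. by left. Qed.
Let face_ok F : F != set0 -> F != setT -> face (@simplex R d) F -> ok F.
Proof. by []. Qed.

Lemma card_simplex_flags : #|{: flag (@simplex R d) d}| = d.+1`!.
Proof.
rewrite (card_simplicial_flags d_gt2 (ltnSn d) e_alt simplex_okS face_ok
  simplex_ok_face simplex_equivariant_ok simplex_ok_equivariant simplex_equivariant_eq).
have -> : d.+1`! = (d.+1 ^_ d)%N.
  by have := ffact_fact (leqnSn d); rewrite subSnn muln1.
rewrite -[X in (X ^_ _)%N]card_ord -[X in (_ ^_ X)%N]card_ord -card_inj_ffuns.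
apply: eq_card => v; rewrite !inE andb_idr // => _.
exact: imset_ord_neqT.
Qed.

Lemma simplex_z_vector : has_z_vector (@simplex R d) d d.+1 (d`! %/ 2).
Proof.
apply: (simplicial_z_vector d_gt2 (ltnSn d) ee0 e_alt simplex_okS face_ok
  simplex_ok_face simplex_equivariant_ok simplex_ok_equivariant
  simplex_equivariant_eq simplex_thin).
rewrite card_simplex_flags factS mulnA divnK; last by apply: dvdn_fact; lia.
by rewrite mulnC.
Qed.

(** For d + 1 > 4 no reflection meets, so each of the d + 1 indices has its own class; for d = 3 one
    shift and one reflection meet, so the four indices pair up into two classes. *)
Lemma simplex_intersection_vector Z : Z \in zigzags (@simplex R d) d ->
  has_intersection_vector Z
    (if d == 3 then (1, 1) else (0, 1))%N (if d == 3 then 2 else d.+1)%N.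
Proof.
have vec b m := @simplicial_intersection_vector R _ _ _ d d.+1 0 ok id d_gt2
  (ltnSn d) ee0 e_alt simplex_okS face_ok
  simplex_ok_face simplex_equivariant_ok simplex_ok_equivariant
  simplex_equivariant_eq simplex_thin 1 b m.
have card1 : #|[set 0; 0 : 'Z_(d.+1)]| = 1%N by rewrite setUid cards1.
case: eqP => [d3|d_neq3].
  by apply: (vec 1 2)%N; rewrite // d3 ?reflection_meets_tetrahedron ?cards1.
apply: (vec 0 d.+1)%N; rewrite ?addn0 ?muln1 //.
by rewrite (reflection_meets_swap01_eq0 d_gt2 (ltnSn d) ee0 e_alt) //; lia.
Qed.

End Simplex.

(** * The cross-polytope *)

Section CrossPolytope.
Local Open Scope ring_scope.
Variables (R : realFieldType) (d : nat).
Hypothesis d_gt2 : (2 < d)%N.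

Let N_gt1 : (1 < 2 * d)%N. Proof. by lia. Qed.
Let d_ltN : (d < 2 * d)%N. Proof. by lia. Qed.
Let e : 'Z_(2 * d) := d%:R.
Let ee0 : e + e = 0. Proof. by rewrite -natrD addnn -mul2n pchar_Zp. Qed.
Let e_alt : e = 0 \/ e = d%:R /\ (d.+1 < 2 * d)%N.
Proof. by right; split=> //; lia. Qed.

Definition antipode (v : 'I_d * bool) := (v.1, ~~ v.2).
Definition antipode_free (F : {set 'I_d * bool}) :=
  [forall v in F, antipode v \notin F].

Implicit Types F : {set 'I_d * bool}.

Lemma antipodeK : involutive antipode.
Proof. by case=> i s; rewrite /antipode /= negbK. Qed.

Lemma antipode_freeP F :
  reflect (forall v, v \in F -> antipode v \notin F) (antipode_free F).
Proof. exact: 'forall_implyP. Qed.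

Lemma antipode_freeS (A B : {set 'I_d * bool}) :
  A \subset B -> antipode_free B -> antipode_free A.
Proof.
move=> /subsetP AB /antipode_freeP freeB; apply/antipode_freeP => v vA.
by apply: contra (freeB v (AB _ vA)); apply: AB.
Qed.

Lemma antipode_free_fst F : antipode_free F -> {in F &, injective fst}.
Proof.
move=> /antipode_freeP freeF [i s] [j t] vF wF /= ij; subst j.
have := freeF _ vF; case: (eqVneq s t) => [-> //|st].
suff -> : antipode (i, s) = (i, t) by rewrite wF.
by congr pair => /=; move: st; case: s {vF}; case: t {wF}.
Qed.

Lemma cross_polytope_value (c : 'cV[R]_d) v :
  (cross_polytope R v *m c) 0 0 = (-1) ^+ v.2 * c v.1 0.
Proof. by rewrite -scalemxAl mxE -rowE mxE. Qed.

(** A functional takes opposite values at antipodes, so an antipodal pair on a supporting hyperplane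
    forces b = 0; the functional then vanishes at every vertex. *)
Lemma cross_polytope_face_ok F : F != set0 -> F != setT ->
  face (@cross_polytope R d) F -> antipode_free F.
Proof.
move=> _ FT [c [b [le_b FE]]]; apply/antipode_freeP => v vF.
apply/negP => avF; case/negP: FT; apply/eqP/setP => u; rewrite inE FE.
have val_antipode w : (cross_polytope R (antipode w) *m c) 0 0 =
    - (cross_polytope R w *m c) 0 0.
  rewrite !cross_polytope_value /=.
  by case: w.2; rewrite ?expr0 ?expr1 ?mul1r ?mulN1r ?opprK.
have b0 : b = 0.
  move: vF avF; rewrite !FE val_antipode => /eqP -> /eqP/eqP.
  by rewrite eqNr => /eqP.
rewrite eq_le le_b /=; have := le_b (antipode u).
by rewrite val_antipode b0 oppr_le0.
Qed.

Lemma cross_polytope_ok_face F : F != set0 -> antipode_free F ->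
  [/\ face (@cross_polytope R d) F, F != setT
    & face_dim (@cross_polytope R d) F = #|F|.-1].
Proof.
move=> F0 freeF; have [v vF] := set0Pn _ F0.
have /antipode_freeP free := freeF.
split; last 1 first.
- apply: (face_dim_axes (axis := fst)) => //; last exact: antipode_free_fst.
  by move=> u _; apply: eqmx_scale; rewrite signr_eq0.
(* The coefficient is 1, -1 or 0 according to whether e_i, - e_i or neither lies in [F]. *)
- exists (\col_i (((i, false) \in F)%:R - ((i, true) \in F)%:R)), 1.
  suff val_F u : (cross_polytope R u *m
      \col_i (((i, false) \in F)%:R - ((i, true) \in F)%:R)) 0 0 =
      (u \in F)%:R - (antipode u \in F)%:R :> R.
    split=> u; rewrite val_F.
      by rewrite lerBlDr ler_wpDr ?ler0n // lern1 leq_b1.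
    have := free u; case: (u \in F) => [/(_ isT)/negPf ->|_].
      by rewrite subr0 eqxx.
    rewrite sub0r; case: (_ \in F); rewrite ?oppr0 eq_sym ?oner_eq0 //.
    by rewrite -subr_eq0 opprK -mulr2n pnatr_eq0.
  by rewrite cross_polytope_value mxE; case: u => i [] /=;
    rewrite ?expr0 ?expr1 ?mul1r ?mulN1r ?opprB.
by apply: contraTneq (free v vF) => ->; rewrite !inE.
Qed.

Lemma cross_polytope_equivariant_ok w : equivariant e antipode w ->
  antipode_free [set w k%:R | k : 'I_d].
Proof.
move=> [w_inj w_e]; apply/antipode_freeP => _ /imsetP[k _ ->]; rewrite -w_e.
apply/imsetP => -[l _ /w_inj]; rewrite -natrD => /natr_Zp_inj.
by have := ltn_ord k; have := ltn_ord l => ld kd /(_ N_gt1); lia.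
Qed.

Lemma cross_polytope_ok_equivariant (v : 'I_d -> 'I_d * bool) : injective v ->
  antipode_free [set v k | k : 'I_d] ->
  exists2 w, equivariant e antipode w & forall k : 'I_d, w k%:R = v k.
Proof.
move=> v_inj /antipode_freeP free.
have v_neq k l : v k <> antipode (v l).
  by move=> vkl; have := free (v l); rewrite -vkl !imset_f // => /(_ isT).
have d_gt0 : (0 < d)%N by lia.
pose k0 := Ordinal d_gt0; pose u m := v (insubd k0 m).
have u_inj m l : (m < d)%N -> (l < d)%N -> u m = u l -> m = l.
  by move=> md ld /v_inj/(congr1 val); rewrite !val_insubd md ld.
(* The second half lists the antipodes of the first; the arguments of [u] stay below [d], so the
   default [k0] is never reached. *)
pose w (x : 'Z_(2 * d)) := if (x < d)%N then u x else antipode (u (x - d)%N).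
have lt_2d (x : 'Z_(2 * d)) : (x < 2 * d)%N.
  by rewrite -[X in (_ < X)%N](Zp_cast N_gt1).
exists w => [|k]; last first.
  by have kd := ltn_ord k; rewrite /w val_Zp_nat // modn_small ?kd /u ?valKd //; lia.
split=> [x y|x].
  have := lt_2d x; have := lt_2d y; rewrite /w.
  case: ifP => xd; case: ifP => yd y2 x2.
  - by move=> /u_inj xy; apply/val_inj/xy.
  - by move=> /v_neq.
  - by move=> /esym/v_neq.
  move=> /(can_inj antipodeK)/u_inj xy; apply: val_inj => /=.
  have : (x - d = y - d)%N by apply: xy; lia.
  by lia.
have [l l2 ->] := ord_natr_Zp x N_gt1; rewrite /w -natrD !val_Zp_nat //.
rewrite (modn_small l2); have [ld|dl] := ltnP l d.
  rewrite modn_small; last by lia.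
  by rewrite ltnNge leq_addl /= addnK.
(* Adding [d] wraps around to l - d, and the two antipodes cancel. *)
have -> : ((l + d) %% (2 * d) = l - d)%N.
  by rewrite -[in LHS](subnK dl) -addnA addnn -mul2n modnDr modn_small //; lia.
by rewrite antipodeK ifT //; lia.
Qed.

Lemma cross_polytope_equivariant_eq w w' :
  equivariant e antipode w -> equivariant e antipode w' ->
  (forall k : 'I_d, w k%:R = w' k%:R) -> w =1 w'.
Proof.
move=> [_ w_e] [_ w_e'] ww' x; have [l l2 ->] := ord_natr_Zp x N_gt1.
have [ld|dl] := ltnP l d; first exact: (ww' (Ordinal ld)).
have ld : (l - d < d)%N by lia.
by rewrite -(subnK dl) natrD w_e w_e' (ww' (Ordinal ld)).
Qed.

(** If [A] extends at all, it has no antipodal pair; then [A] and its antipodes use up 2d - 2 of the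
    2d vertices, and a new vertex must avoid them. *)
Lemma cross_polytope_thin (A : {set 'I_d * bool}) : #|A| = d.-1 ->
  (#|[set u | (u \notin A) && antipode_free (u |: A)]| <= 2)%N.
Proof.
move=> cA; set S := [set u | _].
have [->|[u0]] := set_0Vmem S; first by rewrite cards0.
rewrite inE => /andP[_ free0].
have /antipode_freeP freeA := antipode_freeS (subsetUr _ _) free0.
have cB : #|A :|: antipode @: A| = (d.-1 + d.-1)%N.
  rewrite cardsU card_imset; last exact: can_inj antipodeK.
  rewrite cA (_ : A :&: _ = set0) ?cards0 ?subn0 //.
  apply/setP => v; rewrite !inE; apply/negP => /andP[vA /imsetP[x xA vx]].
  by have := freeA x xA; rewrite -vx vA.
have := cardsC (A :|: antipode @: A); rewrite cB card_prod card_ord card_bool => cC.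
apply: (@leq_trans #|~: (A :|: antipode @: A)|); last by lia.
apply/subset_leq_card/subsetP => v; rewrite !inE => /andP[vA free].
rewrite negb_or vA; apply/imsetP => -[x xA vx].
have /antipode_freeP/(_ x) := free; rewrite !inE xA orbT => /(_ isT).
by rewrite -vx eqxx.
Qed.

(** An ordered facet is a permutation of the axes together with a choice of signs. *)
Lemma card_cross_polytope_flags :
  #|{: flag (@cross_polytope R d) d}| = (2 ^ d * d`!)%N.
Proof.
rewrite (card_simplicial_flags d_gt2 d_ltN e_alt antipode_freeS
  cross_polytope_face_ok cross_polytope_ok_face cross_polytope_equivariant_ok
  cross_polytope_ok_equivariant cross_polytope_equivariant_eq).
pose split_ffun (v : {ffun 'I_d -> 'I_d * bool}) :=
  ([ffun k => (v k).1], [ffun k => (v k).2]).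
have split_inj : injective split_ffun.
  move=> v v' [/ffunP v1 /ffunP v2]; apply/ffunP => k.
  have := v1 k; have := v2 k; rewrite !ffunE.
  by case: (v k) => i s; case: (v' k) => j t /= -> ->.
rewrite -(card_imset _ split_inj).
have -> : (2 ^ d = #|[set: {ffun 'I_d -> bool}]|)%N.
  by rewrite cardsT card_ffun card_bool card_ord.
have -> : d`! = #|[set v : {ffun 'I_d -> 'I_d} | injectiveb v]|.
  by rewrite card_inj_ffuns card_ord ffactnn.
rewrite mulnC -cardsX; apply: eq_card => -[p s]; rewrite !inE /=.
rewrite andbT; apply/imsetP/injectiveP => [[v]|p_inj].
  rewrite inE => /andP[/injectiveP v_inj free] [-> _] i j; rewrite !ffunE => ij.
  by apply/v_inj/(antipode_free_fst free); rewrite ?imset_f.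
exists [ffun k => (p k, s k)].
  rewrite inE; apply/andP; split.
    by apply/injectiveP => i j; rewrite !ffunE => -[/p_inj].
  apply/antipode_freeP => _ /imsetP[k _ ->]; rewrite ffunE.
  apply/imsetP => -[l _]; rewrite ffunE => -[/p_inj ->].
  by case: (s l).
by congr pair; apply/ffunP => k; rewrite !ffunE.
Qed.

Lemma cross_polytope_z_vector :
  has_z_vector (@cross_polytope R d) d (2 * d) (2 ^ (d - 2) * (d - 1)`!).
Proof.
apply: (simplicial_z_vector d_gt2 d_ltN ee0 e_alt antipode_freeS
  cross_polytope_face_ok cross_polytope_ok_face cross_polytope_equivariant_ok
  cross_polytope_ok_equivariant cross_polytope_equivariant_eq
  cross_polytope_thin).
(* A class consists of 4d flags: the factor 4 comes out of 2^d and the factor d out of d!. *)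
rewrite card_cross_polytope_flags.
have -> : (2 ^ d = 2 ^ (d - 2) * 4)%N.
  by rewrite -[in LHS](subnK (ltnW d_gt2)) expnD.
have -> : d`! = (d * (d - 1)`!)%N.
  rewrite -[in LHS](prednK (ltnW (ltnW d_gt2))) factS subn1.
  by rewrite prednK //; lia.
by nia.
Qed.

(** The shifts 0 and d meet and, as 2d > 4, no reflection does; so each class takes up two of the 2d
    indices. *)
Lemma cross_polytope_intersection_vector Z :
  Z \in zigzags (@cross_polytope R d) d ->
  has_intersection_vector Z (0, 2)%N d.
Proof.
apply: (@simplicial_intersection_vector R _ _ _ d (2 * d) e _ _ d_gt2
  d_ltN ee0 e_alt antipode_freeS
  cross_polytope_face_ok cross_polytope_ok_face cross_polytope_equivariant_ok
  cross_polytope_ok_equivariant cross_polytope_equivariant_eq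
  cross_polytope_thin 2 0 d).
- rewrite cards2 (_ : 0 != e) // eq_sym; apply/eqP.
  by move=> /(@natr_Zp_inj _ _ 0 N_gt1); lia.
- by rewrite (reflection_meets_swap01_eq0 d_gt2 d_ltN ee0 e_alt) //; lia.
by rewrite addn0 mulnC.
Qed.

End CrossPolytope.

Theorem proposition4p1 (R : realFieldType) (d : nat) (hd : (3 <= d)%N) :
  [/\ has_z_vector (@simplex R d) d d.+1 (d`! %/ 2),
      forall Z, Z \in zigzags (@simplex R d) d ->
        has_intersection_vector Z
          (if d == 3 then (1, 1) else (0, 1)) (if d == 3 then 2 else d.+1),
      has_z_vector (@cross_polytope R d) d (2 * d) (2 ^ (d - 2) * (d - 1)`!)
    & forall Z, Z \in zigzags (@cross_polytope R d) d ->
        has_intersection_vector Z (0, 2) d].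
Proof.
split.
- exact: simplex_z_vector.
- exact: simplex_intersection_vector.
- exact: cross_polytope_z_vector.
exact: cross_polytope_intersection_vector.
Qed.
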